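(* Let $n\geq 15$ with $n\equiv 3\pmod 4$ and $r=5$. Let $V=\{x_1,\dots,x_{n-10}\}\sqcup\{u_1,\dots,u_5\}\sqcup\{w_1,\dots,w_5\}$ and consider the labelled graph on $V$ with edges: a terminal-1 alternating path on $x_1,\dots,x_{n-10}$; $\{x_{n-10},u_1\}$ with label $2$; $\{u_1,u_2\}$ and $\{u_3,u_4\}$ with label $3$; $\{u_2,u_3\}$ and $\{u_4,u_5\}$ with label $4$; $\{w_1,w_2\}$ and $\{w_3,w_4\}$ with label $3$; $\{w_2,w_3\}$ with the two labels $2$ and $4$; $\{w_4,w_5\}$ with label $4$; and $\{u_4,w_4\}$, $\{u_5,w_5\}$ with label $2$. Then $G\cong A_n$ and $(G,(\rho_0,\dots,\rho_4))$ is a string C-group of rank 5 with Schläfli type $\{n-10,6,6,5\}$.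
   Context: A string group generated by involutions (sggi) of rank $r$ is a pair $(G,(\rho_0,\dots,\rho_{r-1}))$ where $\rho_0,\dots,\rho_{r-1}$ are involutions generating the group $G$ such that $(\rho_i\rho_j)^2=1$ whenever $|i-j|\geq 2$. It is a string C-group if in addition it satisfies the intersection property: for all $J,K\subseteq\{0,\dots,r-1\}$, $\langle \rho_j : j\in J\rangle\cap\langle\rho_k : k\in K\rangle=\langle \rho_j : j\in J\cap K\rangle$. The Schläfli type is $\{p_1,\dots,p_{r-1}\}$ where $p_i$ is the order of $\rho_{i-1}\rho_i$. Labelled-graph convention: the vertex set $V$ is finite, and each edge $\{a,b\}$ ($a\neq b$) carries one or more labels from $\{0,\dots,r-1\}$, the edges carrying any given label being pairwise disjoint; $\rho_k$ denotes the permutation of $V$ equal to the product of the transpositions $(a\,b)$ over all edges $\{a,b\}$ carrying label $k$, and $G=\langle\rho_0,\dots,\rho_{r-1}\rangle\leq \mathrm{Sym}(V)$. A terminal-1 alternating path on vertices $v_1,\dots,v_a$ means the edges $\{v_s,v_{s+1}\}$ ($1\leq s\leq a-1$), where $\{v_s,v_{s+1}\}$ carries label $1$ if $a-s$ is odd and label $0$ if $a-s$ is even (so the last edge carries label 1 and labels alternate; if $a=1$ there are no edges). *)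

(* Defs.v *)
From HB Require Import structures.
From mathcomp Require Import all_boot all_fingroup all_solvable.
Set Implicit Arguments. Unset Strict Implicit. Unset Printing Implicit Defensive.


Section StringCGroup.
Variable gT : finGroupType.

Definition involution (x : gT) : Prop := (x ^+ 2 = 1 /\ x != 1)%g.

Definition gen_sub (r : nat) (rho : nat -> gT) (J : {set 'I_r}) : {set gT} :=
  <<[set rho (val j) | j in J]>>%g.

Definition gen_grp (r : nat) (rho : nat -> gT) : {group gT} :=
  <<[set rho (val j) | j : 'I_r]>>%G.

Definition sggi (r : nat) (rho : nat -> gT) : Prop :=
  (forall i, i < r -> involution (rho i)) /\
  (forall i j, i < r -> j < r -> i.+2 <= j -> ((rho i * rho j) ^+ 2 = 1)%g).

Definition string_C_group (r : nat) (rho : nat -> gT) : Prop :=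
  sggi r rho /\
  (forall J K : {set 'I_r},
      gen_sub rho J :&: gen_sub rho K = gen_sub rho (J :&: K)).

(* Schlafli type {p_1,...,p_{r-1}}, p_i = order of rho_{i-1} rho_i;
   stored 0-based: nth 0 p i = order of rho_i rho_{i+1} *)
Definition schlafli_type (r : nat) (rho : nat -> gT) (p : seq nat) : Prop :=
  size p = r.-1 /\ forall i, i.+1 < r -> #[(rho i * rho i.+1)%g]%g = nth 0 p i.
End StringCGroup.

(* Vertices are 'I_n (0-based):
   x_i (1<=i<=n-10) |-> i-1,  u_j |-> (n-10)+j-1,  w_j |-> (n-5)+j-1. *)
Definition xv (n i : nat) : nat := i.-1.
Definition uv (n j : nat) : nat := (n - 10) + j.-1.
Definition wv (n j : nat) : nat := (n - 5) + j.-1.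

(* terminal-1 alternating path on vertices v_1..v_a (v_s |-> s-1):
   edge {v_s, v_{s+1}} has label 1 if a-s odd, 0 if a-s even *)
Definition alt_path_edges (a : nat) : seq (nat * nat * nat) :=
  [seq ((if odd (a - s) then 1 else 0), s.-1, s) | s <- iota 1 a.-1].

(* labelled edges (label, endpoint, endpoint); an edge with two labels
   appears once per label *)
Definition ledges (n : nat) : seq (nat * nat * nat) :=
  alt_path_edges (n - 10) ++
  [:: (2, xv n (n - 10), uv n 1);
      (3, uv n 1, uv n 2); (3, uv n 3, uv n 4);
      (4, uv n 2, uv n 3); (4, uv n 4, uv n 5);
      (3, wv n 1, wv n 2); (3, wv n 3, wv n 4);
      (2, wv n 2, wv n 3); (4, wv n 2, wv n 3);
      (4, wv n 4, wv n 5);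
      (2, uv n 4, wv n 4); (2, uv n 5, wv n 5)].

Definition tp (n a b : nat) : {perm 'I_n} :=
  match insub a, insub b with
  | Some a', Some b' => tperm a' b'
  | _, _ => 1%g
  end.

Definition rho (n k : nat) : {perm 'I_n} :=
  (\prod_(e <- ledges n | e.1.1 == k) tp n e.1.2 e.2)%g.

(* Main.v *)
(* Put a = n - 10.  Only rho_0 and rho_1 move the first a - 2 vertices of the
   path, and rho_1 = (x_(a-1) x_a) tau, where tau is an odd involution of those
   a - 2 vertices that commutes with rho_2, rho_3 and rho_4.  Conjugating rho_1,
   one finds (p q) tau in the group for all p, q joined to x_(a-1) by the
   available labels among 2, 3, 4; since every rho_i is even, an even permutation
   that acts as a power of tau on the a - 2 vertices is then a product of such
   elements as soon as it moves no other vertices than these.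

   The intersection property reduces to <rho_p, ..., rho_(q-1)> meeting
   <rho_(p+1), ..., rho_q> in <rho_(p+1), ..., rho_(q-1)>.  A group without rho_4
   acts on {u_3, u_4, u_5, w_1, ..., w_5} as a subgroup of <rho_2, rho_3>, so an
   element of the intersection may be assumed to fix these eight vertices.  If the
   larger group on the right contains rho_1, the previous remark applies.  The
   group <rho_3, rho_4> is dihedral of order 10, and its elements can be listed.
   The group <rho_2, rho_3, rho_4> is PSL(2, 11) on 11 points: it preserves a
   biplane, hence contains no 3-cycle (x_a u_1 u_2).  For G = Alt, products of two
   elements (p q) tau give 3-cycles (u_1 u_2 v), first for v among the last twelve
   vertices, then for all v by conjugation with rho_0 and rho_1. *)

Require Import Defs.
From HB Require Import structures.
From mathcomp Require Import all_boot all_fingroup all_solvable.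
From mathcomp Require Import zify.

Set Implicit Arguments.
Unset Strict Implicit.
Unset Printing Implicit Defensive.

(** * Intersection property of string groups *)

Section IntersectionProperty.
Local Open Scope group_scope.
Variables (gT : finGroupType) (r : nat) (x : nat -> gT).

Local Notation H J := (@gen_sub gT r x J).

Canonical gen_sub_group J : {group gT} := Eval hnf in [group of H J].

Definition interval (p q : nat) : {set 'I_r} := [set i : 'I_r | p <= i < q].

Lemma mem_gen_sub (J : {set 'I_r}) (k : 'I_r) : k \in J -> x k \in H J.
Proof. by move=> kJ; apply: mem_gen; apply: imset_f. Qed.

Lemma gen_subS (J K : {set 'I_r}) : J \subset K -> H J \subset H K.
Proof. by move=> sJK; apply: genS; apply: imsetS. Qed.

(** In a finite group the generated subgroup consists of products of generators without inverses, so
    right multiplication by one generator is the only induction step. *)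
Lemma gen_sub_ind (J : {set 'I_r}) (P : gT -> Prop) :
    P 1 ->
    (forall g k, k \in J -> g \in H J -> P g -> P (g * x (val k))) ->
  forall g, g \in H J -> P g.
Proof.
move=> P1 PM g /gen_prodgP[n [c cJ ->]].
suff [] : P (\prod_(i < n) c i) /\ \prod_(i < n) c i \in H J by [].
elim: n c cJ => [|n IHn] c cJ; first by rewrite big_ord0 group1.
have [|Pn Hn] := IHn (fun i => c (widen_ord (leqnSn n) i)); first by move=> i.
rewrite big_ord_recr /=; have /imsetP[k kJ ->] := cJ ord_max.
by split; [apply: PM | rewrite groupM ?mem_gen_sub].
Qed.

(** Relative to a set [A] of indices, which allows induction over intervals. *)
Definition intersection_property (A : {set 'I_r}) : Prop :=
  forall J K : {set 'I_r}, J \subset A -> K \subset A ->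
  H J :&: H K = H (J :&: K).

Lemma gen_sub0 : H set0 = 1.
Proof. by rewrite /gen_sub imset0 gen0. Qed.

Lemma mem_gen_subI (A J K : {set 'I_r}) (g : gT) :
    intersection_property A -> J \subset A -> K \subset A ->
  g \in H J -> g \in H K -> g \in H (J :&: K).
Proof. by move=> ipA sJ sK gJ gK; rewrite -ipA // inE gJ. Qed.

Lemma mem_gen_subS (J K : {set 'I_r}) (g : gT) :
  J \subset K -> g \in H J -> g \in H K.
Proof. by move=> /gen_subS/subsetP; apply. Qed.

Lemma intersection_property_sub (A : {set 'I_r}) :
    (forall J K : {set 'I_r}, J \subset A -> K \subset A ->
       H J :&: H K \subset H (J :&: K)) ->
  intersection_property A.
Proof.
move=> sA J K sJ sK; apply/eqP; rewrite eqEsubset sA //=.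
by rewrite subsetI !gen_subS ?subsetIl ?subsetIr.
Qed.

Hypothesis commute_far : forall i j, i < r -> j < r -> i.+2 <= j ->
  commute (x i) (x j).

Lemma gen_subU (J K : {set 'I_r}) :
    (forall j k : 'I_r, j \in J -> k \in K -> j.+1 < k) ->
  H (J :|: K) = H J * H K.
Proof.
move=> ltJK; rewrite /gen_sub imsetU -joingE -joing_idl -joing_idr.
apply: cent_joinEr; rewrite gen_subG centsC gen_subG.
apply/subsetP=> _ /imsetP[j jJ ->]; apply/centP=> _ /imsetP[k kK ->].
by apply: commute_far; [apply: (ltn_ord j) | apply: (ltn_ord k) | apply: ltJK].
Qed.

(** Once [i] is left out, the indices below it differ from those above it by at least 2, so the two
    sets of generators commute. *)
Lemma gen_sub_split (J : {set 'I_r}) (i : 'I_r) (g : gT) :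
    g \in H J -> i \notin J ->
  exists2 g1, g1 \in H (J :&: interval 0 i) &
  exists2 g2, g2 \in H (J :&: interval i.+1 r) & g = g1 * g2.
Proof.
move=> gJ Ji.
have eJ : J = (J :&: interval 0 i) :|: (J :&: interval i.+1 r).
  apply/setP=> j; rewrite !inE -andb_orr.
  case jJ: (j \in J) => //=; have ltj := ltn_ord j.
  have : val j != val i by apply: contraNneq Ji => /val_inj <-.
  by move: ltj => /=; lia.
move: gJ; rewrite {1}eJ gen_subU; last first.
  by move=> j k; rewrite !inE => /andP[_ ?] /andP[_ ?]; lia.
by case/mulsgP=> g1 g2 ? ? ->; exists g1 => //; exists g2.
Qed.

Ltac lia_no_mem := repeat match goal with
  | H : is_true (_ \in _) |- _ => clear H
  | H : is_true (_ \notin _) |- _ => clear H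
  end; lia.

(* If [g = g1 g2 = k1 k2] splits at [i] and at [k >= i], the middle factor
   [m = k1^-1 g1 = k2 g2^-1] lies in the groups of both shorter intervals, so it
   is generated by the generators strictly between [i] and [k]; this allows one
   to compare [g1] with [k1] in one of them and [g2] with [k2] in the other. *)
Lemma intersection_property_step (p q : nat) :
    q < r ->
    intersection_property (interval p q) ->
    intersection_property (interval p.+1 q.+1) ->
    H (interval p q) :&: H (interval p.+1 q.+1) \subset H (interval p.+1 q) ->
  intersection_property (interval p q.+1).
Proof.
move=> ltqr ip1 ip0 sI; apply: intersection_property_sub => J K sJ sK.
have [->|nJ] := eqVneq J (interval p q.+1).
  by rewrite (setIidPr sK) subsetIr.
have [->|nK] := eqVneq K (interval p q.+1).
  by rewrite (setIidPl sJ) subsetIl.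
have /properP[_ [i iA iJ]] : J \proper interval p q.+1 by rewrite properEneq nJ.
have /properP[_ [k kA kK]] : K \proper interval p q.+1 by rewrite properEneq nK.
move: nJ nK => _ _; wlog le_ik : J K i k sJ sK iA iJ kA kK / i <= k.
  move=> wl; case: (leqP i k) => [le_ik|/ltnW le_ki]; first exact: (wl J K i k).
  by rewrite setIC (setIC J) (wl K J k i).
apply/subsetP=> g; rewrite inE => /andP[gJ gK].
have [g1 g1J [g2 g2J eg]] := gen_sub_split gJ iJ.
have [k1 k1K [k2 k2K ek]] := gen_sub_split gK kK.
have memA (X : {set 'I_r}) (j : 'I_r) :
  X \subset interval p q.+1 -> j \in X -> p <= j <= q.
  by move=> /subsetP sX /sX; rewrite inE.
have sub a b c d (X : {set 'I_r}) : X \subset interval p q.+1 ->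
  (forall j : nat, p <= j <= q -> a <= j < b -> c <= j < d) ->
  X :&: interval a b \subset interval c d.
  move=> sX abcd; apply/subsetP=> j; rewrite !inE => /andP[/(memA _ _ sX)].
  by move=> pj aj; apply: abcd.
move: (iA) (kA); rewrite !inE => ipq kpq.
set m := k1^-1 * g1.
have em : m = k2 * g2^-1.
  by rewrite /m; apply: (mulgI k1); apply: (mulIg g2);
    rewrite !mulgA mulgV mul1g -eg ek mulgKV.
have m1 : m \in H (interval p k).
  rewrite groupM ?groupV; first by [].
    by apply: mem_gen_subS k1K; apply: sub => [//|j]; lia_no_mem.
  by apply: mem_gen_subS g1J; apply: sub => [//|j]; lia_no_mem.
have m2 : m \in H (interval i.+1 q.+1).
  rewrite em groupM ?groupV; first by [].
    by apply: mem_gen_subS k2K; apply: sub => [//|j]; lia_no_mem.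
  by apply: mem_gen_subS g2J; apply: sub => [//|j]; lia_no_mem.
have intS a b c d : (forall j : nat, a <= j < b -> c <= j < d) ->
  interval a b \subset interval c d.
  by move=> abcd; apply/subsetP=> j; rewrite !inE; apply: abcd.
have m01 : m \in H (interval p.+1 q).
  (* As [k <= q] and [p <= i], the element [m] lies in both groups compared by [sI]. *)
  apply: (subsetP sI); rewrite inE; apply/andP; split.
    by apply: mem_gen_subS m1; apply: intS => j; lia_no_mem.
  by apply: mem_gen_subS m2; apply: intS => j; lia_no_mem.
have mM : m \in H (interval i.+1 k).
  have m3 : m \in H (interval p k :&: interval p.+1 q).
    by apply: mem_gen_subI ip1 _ _ m1 m01; apply: intS => j; lia_no_mem.
  have m4 : m \in H (interval i.+1 q.+1 :&: (interval p k :&: interval p.+1 q)).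
    apply: mem_gen_subI ip0 _ _ m2 m3; apply/subsetP=> j; rewrite !inE;
      lia_no_mem.
  by apply: mem_gen_subS m4; apply/subsetP=> j; rewrite !inE; lia_no_mem.
set M := interval i.+1 k in mM.
have k1M : k1 \in H ((K :&: interval 0 k) :&: ((J :&: interval 0 i) :|: M)).
  apply: (mem_gen_subI ip1) => //; first by apply: sub => [//|j]; lia_no_mem.
    by rewrite subUset sub //= ?intS // => j; lia_no_mem.
  have -> : k1 = g1 * m^-1 by rewrite /m invMg invgK mulKVg.
  by rewrite groupM ?groupV; [|apply: mem_gen_subS g1J; apply: subsetUl
                              |apply: mem_gen_subS mM; apply: subsetUr].
have [a aJK [b bK eab]] : exists2 a, a \in H (J :&: K :&: interval 0 i) &
    exists2 b, b \in H (K :&: M) & k1 = a * b.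
  move: k1M; rewrite (_ : _ :&: _ = (J :&: K :&: interval 0 i) :|: (K :&: M)).
    rewrite gen_subU; first by case/mulsgP=> a b ? ? ->; exists a => //;
      exists b.
    by move=> u v; rewrite !inE; lia_no_mem.
  by apply/setP=> j; rewrite !inE; case: (j \in J); case: (j \in K) => //=;
    lia_no_mem.
(* [b * m] equals [a^-1 * g1], generated below [i], while [b] and [m] are generated above [i]; these
   index sets are disjoint. *)
have bm1 : b * m = 1.
  have ebm : b * m = a^-1 * g1 by rewrite /m eab invMg !mulgA mulgV mul1g.
  apply/set1gP; rewrite -gen_sub0.
  rewrite (_ : set0 = interval p i :&: M); last first.
    by apply/setP=> j; rewrite !inE; lia_no_mem.
  apply: (mem_gen_subI ip1); try by apply: intS => j; lia_no_mem.
    rewrite ebm groupM ?groupV; first by [].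
      apply: mem_gen_subS aJK; rewrite setIC setIA setIC.
      by apply: subset_trans (subsetIr _ _) _; rewrite setIC;
        apply: sub => [//|j]; lia_no_mem.
    by apply: mem_gen_subS g1J; apply: sub => [//|j]; lia_no_mem.
  by rewrite groupM //; apply: mem_gen_subS bK; apply: subsetIr.
have g1a : g1 = a.
  by apply: (mulgI k1^-1);
    rewrite -/m eab invMg mulgKV -[m]mul1g -(mulVg b) -mulgA bm1 mulg1.
have mK : m \in H (K :&: M).
  by rewrite -groupV (_ : m^-1 = b) // -[b]mulg1 -(mulgV m) mulgA bm1 mul1g.
have g2M : g2 \in H ((J :&: interval i.+1 r) :&: ((K :&: interval k.+1 r) :|:
  (K :&: M))).
  apply: (mem_gen_subI ip0) => //; first by apply: sub => [//|j]; lia_no_mem.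
    rewrite subUset sub //=; last by move=> j; lia_no_mem.
    by apply: subset_trans (subsetIr _ _) _; apply: intS => j; lia_no_mem.
  have -> : g2 = m^-1 * k2 by rewrite em invMg invgK mulgKV.
  by rewrite groupM ?groupV; [|apply: mem_gen_subS mK; apply: subsetUr
                              |apply: mem_gen_subS k2K; apply: subsetUl].
rewrite eg g1a groupM //.
  by apply: mem_gen_subS aJK; apply: subsetIl.
by apply: mem_gen_subS g2M; apply/subsetP=> j; rewrite !inE; case: (j \in J);
  case: (j \in K) => //=; lia_no_mem.
Qed.

(** Induction on the length of the interval, starting from lengths 0 and 1. *)
Lemma intersection_property_intervals :
    (forall p l, p + l.+1 < r ->
       H (interval p (p + l.+1)) :&: H (interval p.+1 (p + l.+2))
         \subset H (interval p.+1 (p + l.+1))) ->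
  forall J K : {set 'I_r}, H J :&: H K = H (J :&: K).
Proof.
move=> sI J K.
suff ip l p : p + l <= r -> intersection_property (interval p (p + l)).
  have sT (X : {set 'I_r}) : X \subset interval 0 (0 + r).
    by apply/subsetP=> j _; rewrite inE ltn_ord.
  exact: (ip r 0).
elim: l p => [|[|l] IHl] p lepr.
- apply: intersection_property_sub => X Y sX sY.
  suff [-> ->] : X = set0 /\ Y = set0 by rewrite !setIid.
  have e0 : interval p (p + 0) = set0 by apply/setP=> j; rewrite !inE; lia.
  by move: sX sY; rewrite e0 !subset0 => /eqP-> /eqP->.
- have ltpr : p < r by lia.
  have e1 : interval p (p + 1) = [set Ordinal ltpr].
    by apply/setP=> j; rewrite !inE -val_eqE /=; lia.
  apply: intersection_property_sub => X Y; rewrite e1 !subset1.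
  case/orP=> /eqP->; case/orP=> /eqP->;
    by rewrite ?setIid ?set0I ?setI0 ?subsetIl ?subsetIr ?subxx.
- rewrite addnS; apply: intersection_property_step; first lia.
  + by apply: IHl; lia.
  + by rewrite -addnS -addSnnS; apply: IHl; lia.
  by rewrite -addnS; apply: sI; lia.
Qed.

End IntersectionProperty.

(** * Permutations generated by transpositions up to a fixed involution *)

Section Sift.
Local Open Scope group_scope.

(** As [c] is its own inverse, [H] contains both [t * c] and [c * t] for the given transpositions
    [t]. Used alternately, the factors [c] cancel in pairs, and the parity of [s] decides whether
    one is left. *)
Lemma star_sift (T : finType) (H : {group {perm T}}) (S : {set T}) (e : T)
    (c : {perm T}) :
    c * c = 1 -> {in S, forall v, v != e -> tperm e v * c \in H} ->
  forall s, perm_on S s -> s * c ^+ odd_perm s \in H.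
Proof.
move=> cc star.
have starV v w : tperm v w * c \in H -> c * tperm v w \in H.
  move=> vH; rewrite -groupV invMg tpermV.
  by have -> : c^-1 = c by apply: (mulgI c); rewrite mulgV.
have pairs v w : v \in S -> w \in S -> v != w -> tperm v w * c \in H.
  move=> vS wS vw; have [we|we] := eqVneq w e.
    by rewrite tpermC we; apply: star => //; rewrite -we.
  have [->|ve] := eqVneq v e; first exact: star.
  (* [(v w) = (e v)(e w)(e v)], with [c * c] inserted after the first factor. *)
  have -> : tperm v w * c = (tperm e v * c) * (c * tperm e w) * (tperm e v * c).
    have -> : tperm v w = tperm e v * tperm e w * tperm e v.
      rewrite -mulgA -{1}[tperm e v]tpermV -conjgE tpermJ tpermL tpermD //.
      by rewrite eq_sym.
    by rewrite -!mulgA (mulgA c c) cc mul1g.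
  by apply: groupM; [apply: groupM|]; rewrite ?starV ?star.
move=> s; have [k] := ubnP #|[set x | s x != x]|.
elim: k s => // k IHk s ltk sS.
have [/existsP[x sx]|] := boolP [exists x, s x != x]; last first.
  rewrite negb_exists => /forallP s1.
  have -> : s = 1 by apply/permP=> x; rewrite perm1; apply/eqP;
    rewrite -[_ == _]negbK.
  by rewrite odd_perm1 mulg1 group1.
set t := tperm x (s x).
have xS : x \in S by apply: (subsetP sS); rewrite inE.
have sxS : s x \in S by rewrite perm_closed.
have stx : (s * t) x = x by rewrite permM tpermR.
have stS : perm_on S (s * t).
  apply: perm_onM => //; apply: subset_trans (tperm_on _ _) _.
  by apply/subsetP=> y; rewrite !inE => /orP[]/eqP->.
(* [s * t] fixes [x] and every fixed point of [s], so its support is smaller. *)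
have /IHk/(_ stS) : #|[set y | (s * t) y != y]| < k.
  rewrite -ltnS; apply: leq_trans ltk; rewrite ltnS; apply: proper_card;
    apply/properP; split; last first.
    by exists x; rewrite inE ?stx ?eqxx.
  apply/subsetP=> y; rewrite !inE; apply: contraNneq => sy.
  rewrite permM sy tpermD //; first by apply: contraNneq sx => ->; rewrite sy.
  by apply: contraNneq sx => sxy; apply/eqP/(@perm_inj _ s); rewrite sxy sy.
rewrite odd_permM odd_tperm eq_sym sx addbT => stH.
have tH : t * c \in H by apply: pairs => //; rewrite eq_sym.
case: (odd_perm s) stH => /=; rewrite ?expg0 ?expg1 ?mulg1 => stH.
  by have := groupM stH tH; rewrite -!mulgA (mulgA t t) tperm2 mul1g.
have := groupM stH (starV _ _ tH).
by rewrite -!mulgA (mulgA c c) cc mul1g tperm2 mulg1.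
Qed.

(** [star_sift] for the trivial group, with [tperm x y] itself as [c]. *)
Lemma even_perm_on2 (T : finType) (x y : T) (s : {perm T}) :
  odd_perm s = false -> perm_on [set x; y] s -> s = 1.
Proof.
move=> evs sxy.
suff : s * tperm x y ^+ odd_perm s \in (1%G : {group {perm T}}).
  by rewrite evs mulg1 => /set1gP.
apply: (star_sift (e := x)) sxy; first exact: tperm2.
by move=> v; rewrite !inE => /orP[]/eqP-> => [/eqP//|_]; rewrite tperm2.
Qed.
End Sift.

(** * The generators as functions on vertex numbers *)

Section LabelledEdges.
Local Open Scope nat_scope.

Definition swap_edge (i : nat) (e : nat * nat * nat) : nat :=
  if i == e.1.2 then e.2 else if i == e.2 then e.1.2 else i.

Definition good_edge (n : nat) (e : nat * nat * nat) : bool :=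
  [&& e.1.2 < n, e.2 < n & e.1.2 != e.2].

Lemma tpE (n : nat) (e : nat * nat * nat) (x : 'I_n) :
  good_edge n e -> val (tp n e.1.2 e.2 x) = swap_edge (val x) e.
Proof.
case: e => [[k a] b] /and3P[/= lta ltb ab].
rewrite /tp /swap_edge !insubT /= -/(val x).
by case: tpermP => [->|->|/eqP + /eqP]; rewrite -?val_eqE /= ?eqxx //;
  [rewrite eq_sym (negPf ab) | move=> /negPf-> /negPf->].
Qed.

(** Products of permutations act from left to right, hence [foldl]. *)
Lemma prod_tpE (n : nat) (s : seq (nat * nat * nat)) (x : 'I_n) :
    all (good_edge n) s ->
  val ((\prod_(e <- s) tp n e.1.2 e.2)%g x) = foldl swap_edge (val x) s.
Proof.
elim: s x => [|e s IHs] x /=; first by rewrite big_nil perm1.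
by case/andP=> ge gs; rewrite big_cons permM IHs // tpE.
Qed.

Lemma odd_prod_tp (n : nat) (s : seq (nat * nat * nat)) :
    all (good_edge n) s ->
  odd_perm (\prod_(e <- s) tp n e.1.2 e.2)%g = odd (size s).
Proof.
elim: s => [|[[k a] b] s IHs] /=; first by rewrite big_nil odd_perm1.
case/andP=> /and3P[/= lta ltb ab] gs; rewrite big_cons odd_permM IHs //=.
by rewrite /tp !insubT /= odd_tperm -val_eqE /= ab.
Qed.

(** For odd [a] the parities of [a - s] and [s] are opposite, so the labels do not depend on [a]. *)
Definition path_edge (s : nat) : nat * nat * nat :=
  (if odd s then 0 else 1, s.-1, s).

Lemma alt_path_edgesE (a : nat) : odd a ->
  alt_path_edges a = [seq path_edge s | s <- iota 1 a.-1].
Proof.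
move=> odda; apply/eq_in_map => s; rewrite mem_iota => ltsa.
by rewrite /path_edge oddB ?odda; [case: (odd s) | lia].
Qed.

Lemma iota1S (l : nat) : iota 1 l.+1 = iota 1 l ++ [:: l.+1].
Proof. by rewrite -[l.+1]addn1 iotaD add1n addn1. Qed.

Lemma foldl_path_edge0 (l i : nat) :
  foldl swap_edge i [seq e <- [seq path_edge s | s <- iota 1 l] | e.1.1 == 0] =
  if odd i then (if i <= l then i.-1 else i)
  else (if i < l then i.+1 else i).
Proof.
elim: l => [|l IHl]; first by case: i => [|i] //=; case: ifP.
rewrite iota1S map_cat filter_cat foldl_cat {}IHl /=.
case: (boolP (odd l)) => /= oddl; rewrite /swap_edge /=;
 repeat case: ifP; try lia.
Qed.

Lemma foldl_path_edge1 (l i : nat) :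
  foldl swap_edge i [seq e <- [seq path_edge s | s <- iota 1 l] | e.1.1 == 1] =
  if odd i then (if i < l then i.+1 else i)
  else (if 0 < i <= l then i.-1 else i).
Proof.
elim: l => [|l IHl]; first by case: i => [|i] //=; case: ifP.
rewrite iota1S map_cat filter_cat foldl_cat {}IHl /=.
case: (boolP (odd l)) => /= oddl; rewrite /swap_edge /=;
 repeat case: ifP; try lia.
Qed.

Lemma size_path_edge (k l : nat) : k < 2 ->
  size [seq e <- [seq path_edge s | s <- iota 1 l] | e.1.1 == k] =
  if k == 0 then uphalf l else half l.
Proof.
move=> ltk2; elim: l => [|l IHl]; first by case: ifP.
rewrite iota1S map_cat filter_cat size_cat {}IHl /=.
case: (boolP (odd l)) => /= oddl; case: k ltk2 => [|[|]] //= _; lia.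
Qed.
End LabelledEdges.

(** * The action of the generators on the path and on the last twelve vertices *)

Section Model.
Variable m : nat.
Local Open Scope nat_scope.
Local Notation n := m.+4.+4.+4.
Local Notation rho := (rho n).

(* The last twelve vertices [x_(a-1), x_a, u_1, ..., u_5, w_1, ..., w_5], where
   [a = n - 10 = m + 2], are numbered 0, ..., 11. *)
Definition hi (j : nat) : 'I_n := inord (m + j).

(* Row [k] lists the images under [rho k]; row 0 is empty because [rho 0] moves
   vertex 0 out of this range. *)
Definition table (k : nat) : seq nat :=
  nth [::] [:: [::];
    [:: 1; 0; 2; 3; 4;  5; 6;  7; 8; 9; 10; 11];
    [:: 0; 2; 1; 3; 4; 10; 11; 7; 9; 8; 5; 6];
    [:: 0; 1; 3; 2; 5;  4; 6;  8; 7; 10; 9; 11];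
    [:: 0; 1; 2; 4; 3;  6; 5;  7; 9; 8; 11; 10]] k.

Definition act (k j : nat) : nat := nth 0 (table k) j.

Lemma val_hi (j : nat) : j < 12 -> val (hi j) = m + j.
Proof. by move=> ltj; rewrite /= inordK //; lia. Qed.

Lemma hi_lt (x : 'I_n) : m <= x -> exists2 j, j < 12 & x = hi j.
Proof.
move=> lemx; have ltx := ltn_ord x; exists (x - m); first by lia.
by apply: val_inj; rewrite val_hi /=; lia.
Qed.

Lemma hi_inj (i j : nat) : i < 12 -> j < 12 -> hi i = hi j -> i = j.
Proof. by move=> lti ltj /(congr1 val); rewrite !val_hi //; lia. Qed.

Hypothesis m_mod4 : m %% 4 = 3.

Definition fiber (k : nat) := [seq e <- ledges n | e.1.1 == k].

Lemma fiberE k : fiber k =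
  [seq e <- [seq path_edge s | s <- iota 1 m.+1] | e.1.1 == k] ++
  [seq e <- [:: (2, m + 1, m + 2); (3, m + 2, m + 3); (3, m + 4, m + 5);
      (4, m + 3, m + 4); (4, m + 5, m + 6);
      (3, m + 7, m + 8); (3, m + 9, m + 10);
      (2, m + 8, m + 9); (4, m + 8, m + 9); (4, m + 10, m + 11);
      (2, m + 5, m + 10); (2, m + 6, m + 11)] | e.1.1 == k].
Proof.
rewrite /fiber /ledges /uv /wv /xv filter_cat (_ : n - 10 = m.+2); last lia.
rewrite alt_path_edgesE; last by rewrite /= negbK; lia.
congr (_ ++ [seq e <- _ | _]).
rewrite (_ : n - 5 = m + 7); last lia.
by do 12!(congr (_ :: _); first by congr (_, _, _); lia).
Qed.

Lemma good_fiber k : all (good_edge n) (fiber k).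
Proof.
rewrite fiberE all_cat; apply/andP; split.
  apply/allP=> e; rewrite mem_filter => /andP[_ /mapP[s]].
  by rewrite mem_iota /good_edge => lts -> /=; lia.
rewrite all_filter; apply/allP=> e; rewrite /good_edge !inE.
by repeat (case/predU1P=> [->|]; first by rewrite /=; lia); move=> /eqP-> /=;
  lia.
Qed.

Lemma rhoE k x : val (rho k x) = foldl swap_edge (val x) (fiber k).
Proof. by rewrite -prod_tpE ?good_fiber // big_filter. Qed.

Lemma path_fiber0 k : 1 < k ->
  [seq e <- [seq path_edge s | s <- iota 1 m.+1] | e.1.1 == k] = [::].
Proof.
move=> lt1k; apply/eqP; rewrite -[_ == _]negbK -has_filter; apply/hasPn=> e.
by case/mapP=> s _ -> /=; case: (odd s); lia.
Qed.

Lemma rho0E x : val (rho 0 x) =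
  if odd x then (if x <= m.+1 then x.-1 else val x)
  else (if x < m.+1 then x.+1 else val x).
Proof. by rewrite rhoE fiberE foldl_cat foldl_path_edge0. Qed.

Lemma rho1E x : val (rho 1 x) =
  if odd x then (if x < m.+1 then x.+1 else val x)
  else (if 0 < x <= m.+1 then x.-1 else val x).
Proof. by rewrite rhoE fiberE foldl_cat foldl_path_edge1. Qed.

(** [act 0] is constantly 0 by the default of [nth], so the bound covers [k = 0] as well. *)
Lemma act_lt k j : k < 5 -> j < 12 -> act k j < 12.
Proof.
move=> ltk ltj; have /allP : all (fun k => all (fun j => act k j < 12) (iota 0
  12)) (iota 0 5) by [].
by move=> /(_ k); rewrite mem_iota => /(_ ltk)/allP/(_ j); rewrite mem_iota;
  apply.
Qed.

Lemma rho_hi k j : 0 < k < 5 -> j < 12 -> rho k (hi j) = hi (act k j).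
Proof.
move=> ltk ltj; apply: val_inj.
have lta : act k j < 12 by apply: act_lt => //; case/andP: ltk.
rewrite (val_hi lta).
rewrite rhoE fiberE foldl_cat val_hi //.
case: k ltk lta => [|[|k]] // ltk lta.
  rewrite foldl_path_edge1 /=; do 12!(case: j ltj lta => [|j] ltj lta;
    first by rewrite /act /=; repeat case: ifP; lia).
  by [].
rewrite path_fiber0 //=.
case: k ltk lta => [|[|[|]]] //= _ lta; do 12!(case: j ltj lta => [|j] ltj lta;
    first by rewrite /swap_edge /= ?eqn_add2l); by [].
Qed.

Lemma rho_lo k (x : 'I_n) : 1 < k -> x < m -> rho k x = x.
Proof.
move=> lt1k ltx; apply: val_inj; rewrite rhoE fiberE path_fiber0 //.
set s := filter _ _; have : all (fun e => (m <= e.1.2) && (m <= e.2)) s.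
  by rewrite all_filter /= !leq_addr /= !implybT.
move: s => s; elim: s => //= e s IHs /andP[/andP[me1 me2] /IHs IH].
by rewrite /swap_edge !ifN_eq ?IH // neq_ltn (leq_trans ltx).
Qed.

Lemma rho1_lo (x : 'I_n) : x < m -> rho 1 x < m.
Proof. by move=> ltx; rewrite [X in X < _]rho1E; rewrite /=; repeat case: ifP;
  lia. Qed.

Lemma rho0_hi j : 0 < j < 12 -> rho 0 (hi j) = hi j.
Proof.
case/andP=> j0 ltj; apply: val_inj; rewrite rho0E val_hi //.
by repeat case: ifP; lia.
Qed.

(** The path has [m + 1] edges, a multiple of 4, so labels 0 and 1 each occur on an even number of
    them; labels 2, 3 and 4 occur on four edges each. *)
Lemma odd_rho k : odd_perm (rho k) = false.
Proof.
rewrite /Defs.rho -big_filter -/(fiber k) odd_prod_tp ?good_fiber //.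
rewrite fiberE size_cat; case: k => [|[|k]].
- by rewrite size_path_edge //=; lia.
- by rewrite size_path_edge //=; lia.
by rewrite path_fiber0 //; case: k => [|[|[|k]]].
Qed.

Local Open Scope group_scope.
Local Notation H J := (@gen_sub _ 5 rho J).
Local Notation I p q := (@interval 5 p q).

Lemma vertexP (P : 'I_n -> Prop) :
  (forall x : 'I_n, x < m -> P x) -> (forall j, j < 12 -> P (hi j)) ->
  forall x, P x.
Proof.
move=> Plo Phi x; case: (ltnP x m) => [|lemx]; first exact: Plo.
by have [j ltj ->] := hi_lt lemx; apply: Phi.
Qed.

Lemma rhoK k : k < 5 -> involutive (rho k).
Proof.
move=> ltk x; case: k ltk => [|[|k]] ltk.
- apply: val_inj; rewrite !rho0E.
  by repeat case: ifP; have := ltn_ord x; rewrite /=; lia.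
- apply: val_inj; rewrite !rho1E.
  by repeat case: ifP; have := ltn_ord x; rewrite /=; lia.

elim/vertexP: x => [x ltx|j ltj]; first by rewrite !rho_lo.
rewrite !rho_hi ?act_lt //; congr hi.
case: k ltk => [|[|[|]]] //= _; do 12!(case: j ltj => [|j] ltj //).
Qed.

Lemma rhoV k : k < 5 -> (rho k)^-1 = rho k.
Proof.
move=> ltk; apply: (mulgI (rho k)); rewrite mulgV.
by apply/permP=> x; rewrite permM rhoK // perm1.
Qed.

Lemma rho0_le (x : 'I_n) : x <= m -> rho 0 x <= m.
Proof.
move=> lex; rewrite [X in X <= _]rho0E /=.
by repeat case: ifP; lia.
Qed.

Lemma rho0_gt (x : 'I_n) : m < x -> rho 0 x = x.
Proof.
move=> ltx; have [j ltj ex] := hi_lt (ltnW ltx).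
rewrite ex rho0_hi //; move: ltx; rewrite ex.
by have := val_hi ltj => /= ->; lia.
Qed.

(** [rho 0] moves only vertices up to [m], which [rho 2], [rho 3] and [rho 4] fix. For [i > 0] the
    table decides on the last twelve vertices, and at most [rho 1] moves the others. *)
Lemma rho_commute i j : i < 5 -> j < 5 -> i.+2 <= j -> commute (rho i) (rho j).
Proof.
move=> lti ltj ltij; apply/permP=> x; rewrite !permM.
case: i lti ltij => [|i] lti ltij.
  have fix_j (y : 'I_n) : y <= m -> rho j y = y.
    rewrite leq_eqVlt => /predU1P[ey|lty]; last exact: rho_lo.
    have -> : y = hi 0 by apply: val_inj; rewrite val_hi //= addn0.
    rewrite rho_hi //; last by lia.
    by case: j ltj ltij => [|[|[|[|[|]]]]].
  case: (leqP x m) => [lex|ltx]; first by rewrite !fix_j ?rho0_le.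
  rewrite !rho0_gt // ltnNge; apply/negP=> lejx.
  have := fix_j _ lejx; move/perm_inj=> ejx; move: lejx; rewrite ejx; lia.
elim/vertexP: x => [x ltx|k ltk].
  rewrite [rho j x]rho_lo //; last by lia.
  rewrite rho_lo //; first by lia.
  case: i lti {ltij} => [|i] lti; first exact: rho1_lo.
  by rewrite rho_lo.
rewrite !rho_hi ?act_lt //; try lia.
congr hi; case: i lti ltij => [|[|[|]]] //=;
  case: j ltj => [|[|[|[|[|]]]]] //= _ _ _;
 do 12!(case: k ltk => [|k] ltk //).
Qed.
(** * Structure of the interval subgroups *)

Definition tau : {perm 'I_n} := rho 1 * tperm (hi 0) (hi 1).

Lemma hi_neq i j : i < 12 -> j < 12 -> i != j -> hi i != hi j.
Proof. by move=> lti ltj; apply: contraNneq => /hi_inj->. Qed.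

Lemma lo_neq_hi (x : 'I_n) j : x < m -> j < 12 -> hi j != x.
Proof.
by move=> ltx ltj; apply: contraTneq ltx => <-; rewrite -leqNgt;
  have /= -> := val_hi ltj; lia.
Qed.

Lemma tau_lo (x : 'I_n) : x < m -> tau x = rho 1 x.
Proof. by move=> ltx; rewrite permM tpermD // lo_neq_hi // rho1_lo. Qed.

Lemma tau_hi j : j < 12 -> tau (hi j) = hi j.
Proof.
move=> ltj; rewrite permM rho_hi //; case: j ltj => [|[|j]] ltj.
- by rewrite tpermR.
- by rewrite tpermL.
have -> : act 1 j.+2 = j.+2 by do 10!(case: j ltj => [|j] ltj //).
by rewrite tpermD // hi_neq.
Qed.

Lemma tauK : involutive tau.
Proof.
elim/vertexP=> [x ltx|j ltj]; last by rewrite !tau_hi.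
by rewrite [tau x]tau_lo // tau_lo ?rho1_lo // rhoK.
Qed.

Lemma tau2 : tau * tau = 1.
Proof. by apply/permP=> x; rewrite permM tauK perm1. Qed.

Lemma odd_tau : odd_perm tau.
Proof. by rewrite odd_permM odd_rho odd_tperm hi_neq. Qed.

Lemma tperm_tau : tperm (hi 0) (hi 1) * tau = rho 1.
Proof.
have /conjg_fixP/commgP -> : tperm (hi 0) (hi 1) ^ tau = tperm (hi 0) (hi 1).
  by rewrite tpermJ !tau_hi.
by rewrite /tau -mulgA tperm2 mulg1.
Qed.

Lemma tau_rho k : 1 < k -> k < 5 -> commute tau (rho k).
Proof.
move=> lt1k ltk; apply/permP; elim/vertexP=> [x ltx|j ltj];
  rewrite [LHS]permM [RHS]permM.
  by rewrite [rho k x]rho_lo // tau_lo // rho_lo // rho1_lo.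
by rewrite tau_hi // rho_hi ?tau_hi ?act_lt //; lia.
Qed.

Lemma gen_sub_even (J : {set 'I_5}) g : g \in H J -> odd_perm g = false.
Proof.
by move: g; apply: gen_sub_ind => [|g k kJ _ evg];
  rewrite ?odd_perm1 // odd_permM evg odd_rho.
Qed.

Lemma gen_sub_fix (J : {set 'I_5}) (x : 'I_n) :
  (forall k, k \in J -> rho (val k) x = x) -> forall g, g \in H J -> g x = x.
Proof.
move=> fixJ; apply: gen_sub_ind => [|g k kJ _ gx]; first exact: perm1.
by rewrite permM gx fixJ.
Qed.

(** On the first [m] vertices [rho 1] acts as [tau], and the later generators act trivially. *)
Lemma gen_sub_lo (J : {set 'I_5}) : (forall k : 'I_5, k \in J -> 0 < k) ->
  forall g, g \in H J ->
  exists b : bool, forall x : 'I_n, x < m -> g x = (tau ^+ b) x.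
Proof.
move=> J0; apply: gen_sub_ind => [|g k kJ _ [b gE]]; first by exists false.
have [k1|k1] := eqVneq (val k) 1%N.
  exists (~~ b) => x ltx; rewrite permM gE // k1.
  by case: b {gE}; rewrite /= ?expg1 ?perm1 ?tau_lo // rhoK.
exists b => x ltx; rewrite permM gE // rho_lo //;
  first by move: k1 (J0 _ kJ) => /=; lia.
by case: b {gE}; rewrite /= ?expg1 ?perm1 ?tau_lo ?rho1_lo.
Qed.

Lemma mem_interval (p q k : nat) : p <= k < q -> k < 5 -> rho k \in H (I p q).
Proof.
by move=> pkq lt5; rewrite (mem_gen_sub rho (k := Ordinal lt5)) ?inE.
Qed.

(* The edges inside the last eight vertices carry labels 2, 3 and 4 only, and
   the label 4 is absent from the generators considered. *)
Lemma gen_sub_tail (p q : nat) g : q <= 4 -> g \in H (I p q) ->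
  exists2 d, d \in H (I (maxn p 2) q) & forall j, 4 <= j < 12 -> g (hi j) = d
    (hi j).
Proof.
move=> leq4 gH.
(* The induction must also carry that [g] preserves the set of the last eight vertices. *)
suff [d [dH gd _]] : exists d, [/\ d \in H (I (maxn p 2) q),
    forall j, 4 <= j < 12 -> g (hi j) = d (hi j) &
    forall j, 4 <= j < 12 -> exists2 i, 4 <= i < 12 & g (hi j) = hi i] by
      exists d.
move: g gH; apply: gen_sub_ind => [|g [k ltk5]].
  by exists 1; split=> // j ltj; exists j; rewrite ?perm1.
rewrite inE /= => pkq _ [d [dH gd gs]].
have stab : forall j, 4 <= j < 12 -> exists2 i, 4 <= i < 12 & (g * rho k) (hi
  j) = hi i.
  move=> j /gs[i lei gi]; rewrite permM gi.
  case: (posnP k) => [k0|k0]; first by exists i; rewrite ?k0 ?rho0_hi //; lia.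
  exists (act k i); last by apply: rho_hi; lia.
  have {k0 pkq ltk5 gi} : (k == 1%N) || (k == 2) || (k == 3) by lia.
  by case/orP=> [/orP[]|] /eqP->; do 12!(case: i lei => [|i] lei //).
have [le2k|ltk2] := leqP 2 k.
  exists (d * rho k); split=> //; first by rewrite groupM ?mem_interval //; lia.
  by move=> j ltj; rewrite !permM gd.
exists d; split=> // j ltj; rewrite -gd // permM; have [i lei ->] := gs j ltj.
case: (posnP k) => [->|k0]; first by rewrite rho0_hi //; lia.
have -> : k = 1%N by lia.
by rewrite rho_hi //; [congr hi; do 12!(case: i lei => [|i] lei //) | lia].
Qed.

(** [g * tau ^+ b] is supported on [s], and its parity is [b] because [g] is even and [tau] odd;
    [star_sift] with [c = tau] multiplies it by [tau ^+ b] again, which gives [g]. *)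
Lemma star_hi (L : {group {perm 'I_n}}) (s : {set 'I_n}) (g : {perm 'I_n}) (b :
  bool) :
    (forall v, v \in s -> v != hi 0 -> tperm (hi 0) v * tau \in L) ->
    odd_perm g = false -> s \subset [set x : 'I_n | m <= x] ->
    (forall x : 'I_n, x < m -> g x = (tau ^+ b) x) ->
    (forall j, j < 12 -> hi j \notin s -> g (hi j) = hi j) ->
  g \in L.
Proof.
move=> star evg shi glo ghi.
have tbK x : (tau ^+ b) ((tau ^+ b) x) = x.
  by case: b {glo}; rewrite /= ?expg1 ?tauK ?perm1.
have : (g * tau ^+ b) * tau ^+ odd_perm (g * tau ^+ b) \in L.
  apply: (star_sift tau2 star); apply/subsetP=> x; rewrite inE.
  elim/vertexP: x => [x ltx|j ltj]; first by rewrite permM glo // tbK eqxx.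
  apply: contraNT => js; rewrite permM ghi //.
  by case: b {glo tbK}; rewrite ?expg1 ?tau_hi // perm1.
rewrite odd_permM evg (_ : odd_perm (tau ^+ b) = b); last first.
  by case: b {glo tbK}; rewrite ?expg1 ?odd_tau // odd_perm1.
by rewrite -mulgA (_ : tau ^+ b * tau ^+ b = 1) ?mulg1 //; apply/permP=> x;
  rewrite permM tbK perm1.
Qed.

(** For these [k], [rho k] commutes with [tau] and fixes [hi 0], so conjugation by it only moves
    [v]. *)
Lemma star_step (L : {group {perm 'I_n}}) k v : 1 < k < 5 -> rho k \in L ->
  tperm (hi 0) v * tau \in L -> tperm (hi 0) (rho k v) * tau \in L.
Proof.
move=> ltk kL vL.
have <- : (tperm (hi 0) v * tau) ^ rho k = tperm (hi 0) (rho k v) * tau.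
  rewrite conjMg tpermJ /conjg (tau_rho (k := k)) ?mulKg; try lia.
  congr (tperm _ _ * _); rewrite rho_hi //; last lia.
  by case: k ltk {kL} => [|[|[|[|[|]]]]].
by rewrite groupJ.
Qed.

Lemma star1 (p q : nat) : p <= 1 < q -> tperm (hi 0) (hi 1) * tau \in H (I p q).
Proof. by move=> ?; rewrite tperm_tau mem_interval. Qed.

Lemma gen_sub_intervalS (p q a b : nat) g :
  a <= p -> q <= b -> g \in H (I p q) -> g \in H (I a b).
Proof.
by move=> leap leqb; apply: mem_gen_subS; apply/subsetP=> k; rewrite !inE; lia.
Qed.

Lemma rho_fix k j : 0 < k < 5 -> j < 12 -> act k j == j -> rho k (hi j) = hi j.
Proof. by move=> ltk ltj /eqP e; rewrite rho_hi // e. Qed.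

(** [hi 0] is the only [hi j] moved by [rho 0], whose row in [table] is empty; hence the condition
    on [p] and [j]. *)
Lemma fix_interval (p q j : nat) g :
    j < 12 -> (0 < p) || (0 < j) ->
    (forall k, 0 < k -> p <= k < q -> act k j == j) ->
  g \in H (I p q) -> g (hi j) = hi j.
Proof.
move=> ltj pj fixk; apply: gen_sub_fix => -[k ltk5]; rewrite inE /= => pkq.
case: (posnP k) => [k0|k0]; first by rewrite k0 rho0_hi //; lia.
by rewrite rho_fix ?fixk // k0.
Qed.

Lemma fix_lo (p q : nat) g (x : 'I_n) :
  1 < p -> x < m -> g \in H (I p q) -> g x = x.
Proof.
move=> ltp ltx; apply: gen_sub_fix => -[k ltk5]; rewrite inE /= => pkq.
by rewrite rho_lo //; lia.
Qed.

(** * Intersections of the groups of two shifted intervals *)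

(** Once [g] fixes the last eight vertices, the second group makes it a power of [tau] on the first
    [m] vertices, and the first group makes it fix [hi j] for [t <= j < 4]. Then [star_hi] applies
    to [hi 0], ..., [hi (t - 1)]. *)
Lemma inter_prefix (t : nat) : 2 <= t <= 4 ->
  H (I 0 t) :&: H (I 1 t.+1) \subset H (I 1 t).
Proof.
move=> let4; apply/subsetP=> g; rewrite inE => /andP[g0 g1].
have [d dH gd] : exists2 d, d \in H (I 2 t) & forall j, 4 <= j < 12 -> g (hi j)
  = d (hi j).
  by apply: (gen_sub_tail (p := 0)) => //; lia.
have dI a b : a <= 2 -> t <= b -> d \in H (I a b).
  by move=> a2 tb; apply: gen_sub_intervalS dH.
suff : g * d^-1 \in H (I 1 t) by rewrite groupMr // groupV dI.
have h0 : g * d^-1 \in H (I 0 t) by rewrite groupM ?groupV ?dI.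
have h1 : g * d^-1 \in H (I 1 t.+1) by rewrite groupM ?groupV ?dI //; lia.
have htail j : 4 <= j < 12 -> (g * d^-1) (hi j) = hi j.
  by move=> ltj; rewrite permM gd // permK.
move: (g * d^-1) h0 h1 htail => {g0 g1 d dH gd dI}{}g g0 g1 gtail.
have [b gb] := gen_sub_lo (J := I 1 t.+1) (ltac:(by move=> k;
  rewrite inE => /andP[])) g1.
apply: (star_hi (s := [set x in [seq hi j | j <- iota 0 t]]) (b := b)) => //.
- move=> v; rewrite inE => /mapP[j]; rewrite mem_iota => /andP[_ ltj] -> j0.
  have s1 : tperm (hi 0) (hi 1) * tau \in H (I 1 t) by apply: star1; lia.
  have step k : 1 < k < t -> tperm (hi 0) (hi k.-1) * tau \in H (I 1 t) ->
      tperm (hi 0) (hi k) * tau \in H (I 1 t).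
    (* For [k = 2, 3] the edge from [hi k.-1] to [hi k] carries label [k]. *)
    move=> ltk sk; rewrite (_ : hi k = rho k (hi k.-1)); last first.
      rewrite rho_hi; try lia; congr hi; have {sk} : k < 4 by lia.
      by case: k ltk => [|[|[|[|]]]].
    by apply: star_step => //; [lia | apply: mem_interval; lia].
  case: j ltj j0 => [|[|[|[|j]]]] //=; rewrite ?eqxx // => ltj _.
  + by apply: (step 2); [lia|].
  + by apply: (step 3); [lia|]; apply: (step 2); [lia|].
  by lia.
- exact: gen_sub_even g0.
- apply/subsetP=> v; rewrite !inE => /mapP[j]; rewrite mem_iota => ltj ->.
  by have /= -> := val_hi (j := j); lia.
move=> j ltj; rewrite inE => jt.
have {jt} letj : t <= j.
  by rewrite leqNgt; apply: contraNN jt => ltjt; apply: map_f; rewrite mem_iota.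
have [lt4|le4] := leqP 4 j; first by rewrite gtail ?lt4.
apply: fix_interval g0 => //; first by lia.
by move=> k; case: k => [|[|[|[|]]]] //; move: le4 letj;
  case: j {ltj} => [|[|[|[|]]]] //; lia.
Qed.

(** After division by [d], only [hi 1] and [hi 2] can still move, and an even permutation of two
    points is trivial. *)
Lemma inter_12_23 : H (I 1 3) :&: H (I 2 4) \subset H (I 2 3).
Proof.
apply/subsetP=> g; rewrite inE => /andP[g1 g2].
have [d dH gd] : exists2 d, d \in H (I 2 3) & forall j, 4 <= j < 12 -> g (hi j)
  = d (hi j).
  exact: (gen_sub_tail (p := 1)).
suff : g * d^-1 \in H (I 2 3) by rewrite groupMr // groupV.
have h1 : g * d^-1 \in H (I 1 3).
  by rewrite groupM ?groupV //; apply: gen_sub_intervalS dH.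
have h2 : g * d^-1 \in H (I 2 4).
  by rewrite groupM ?groupV //; apply: gen_sub_intervalS dH.
have htail j : 4 <= j < 12 -> (g * d^-1) (hi j) = hi j.
  by move=> ltj; rewrite permM gd // permK.
rewrite [g * _](_ : _ = 1) ?group1 //.
apply: (even_perm_on2 (x := hi 1) (y := hi 2)); first exact: gen_sub_even h1.
apply/subsetP=> x; rewrite !inE.
elim/vertexP: x => [x ltx|j ltj]; first by rewrite (fix_lo _ ltx h2) ?eqxx.
case: j ltj => [|[|[|[|j]]]] ltj; rewrite ?eqxx ?orbT //.
- by rewrite (fix_interval _ _ _ h2) ?eqxx // => -[|[|[|[|]]]].
- by rewrite (fix_interval _ _ _ h1) ?eqxx // => -[|[|[|[|]]]].
by rewrite htail ?eqxx.
Qed.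

Lemma inter_consecutive p : p < 4 -> H (I p p.+1) :&: H (I p.+1 p.+2) = 1.
Proof.
move=> ltp; apply/eqP; rewrite eqEsubset sub1G andbT; apply/subsetP=> g.
have H1 k y : k < 5 -> y \in H (I k k.+1) -> y = 1 \/ y = rho k.
  move=> ltk; move: y; apply: gen_sub_ind => [|y [i lti]]; first by left.
  rewrite inE /= => kik _; have {kik lti} -> : i = k by lia.
  case=> ->; [right | left]; first exact: mul1g.
  by apply/permP=> x; rewrite permM rhoK // perm1.
rewrite !inE => /andP[/H1[|->|gp]]; rewrite ?eqxx //; first by lia.
case/H1=> [|->|gq]; rewrite ?eqxx //.
(* Exactly one of [rho p] and [rho p.+1] moves [hi j]. *)
pose j := if p == 0 then 1%N else p.-1.
have : rho p (hi j) = rho p.+1 (hi j) by rewrite -gp gq.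
rewrite {}/j {H1 gp gq}; case: p ltp => [|[|[|[|]]]] //= _;
  rewrite ?rho0_hi ?rho_hi // => /hi_inj; by move/(_ isT isT).
Qed.
(** Without [rho 0] the last twelve vertices are preserved; encoding the action there as a list of
    images makes invariants [Q] checkable by computation. *)
Lemma gen_sub_tuple (J : {set 'I_5}) (Q : seq nat -> Prop) :
    (forall k : 'I_5, k \in J -> 0 < k) -> Q (iota 0 12) ->
    (forall (k : 'I_5) t, k \in J -> size t = 12%N -> all (gtn 12) t -> Q t ->
       Q [seq act k i | i <- t]) ->
  forall g, g \in H J -> exists t, [/\ Q t, size t = 12%N, all (gtn 12) t &
    forall j, j < 12 -> g (hi j) = hi (nth 0 t j)].
Proof.
move=> J0 Q0 QS; apply: gen_sub_ind => [|g k kJ _ [t [Qt st at12 gt]]].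
  by exists (iota 0 12); split=> // j ltj; rewrite perm1 nth_iota.
have lt5 := ltn_ord k; have k0 := J0 _ kJ.
exists [seq act k i | i <- t]; split.
- exact: QS.
- by rewrite size_map.
- apply/allP=> _ /mapP[i it ->]; apply: act_lt => //.
  by have /allP/(_ i it) := at12.
move=> j ltj; rewrite permM gt // (nth_map 0) ?st // rho_hi ?k0 //.
by have /all_nthP/(_ j) := at12; rewrite st; apply.
Qed.

Lemma inter_23_34 : H (I 2 4) :&: H (I 3 5) \subset H (I 3 4).
Proof.
(* The alternating words of length 0 to 9 in labels 3 and 4 give all ten elements of the dihedral
   group. *)
pose L := [seq foldl (fun t k => [seq act k i | i <- t]) (iota 0 12) (take l
  [:: 3; 4; 3; 4; 3; 4; 3; 4; 3])
            | l <- iota 0 10].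
apply/subsetP=> g; rewrite inE => /andP[g2 g3].
have [t [tL stt at12 gt]] : exists t, [/\ t \in L, size t = 12%N, all (gtn 12)
  t &
    forall j, j < 12 -> g (hi j) = hi (nth 0 t j)].
  apply: gen_sub_tuple g3 => [[k ltk]|//|[k ltk] t]; rewrite inE /=;
    first by lia.
  have LS i : i \in [:: 3;
    4] -> forall t, t \in L -> [seq act i u | u <- t] \in L.
    move=> iL {}t tL; have /allP/(_ i iL)/allP/(_ t tL) // :
      all (fun i => all (fun t => [seq act i u | u <- t] \in L) L) [:: 3; 4].
    by vm_compute.
  by move=> pk _ _; apply: LS; rewrite !inE; lia.
(* The orbit of [hi 6] under [rho 2] and [rho 3] is [hi 6], [hi 11]. In [L] only the identity and
   [rho 3] send [hi 6] into it. *)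
have [t' [t'6 _ _ gt']] : exists t, [/\ nth 0 t 6 \in [:: 6;
  11], size t = 12%N, all (gtn 12) t &
    forall j, j < 12 -> g (hi j) = hi (nth 0 t j)].
  apply: (gen_sub_tuple (Q := fun t => nth 0 t 6 \in [:: 6;
    11])) g2 => [[k ltk]|//|[k ltk] t0]; rewrite inE /=; first by lia.
  move=> pk st0 _; rewrite (nth_map 0) ?st0 //.
  have : (k == 2) || (k == 3) by lia.
  by case/orP=> /eqP->; rewrite !inE => /orP[]/eqP->.
have t6 : nth 0 t 6 \in [:: 6; 11].
  have := gt 6 isT; rewrite gt' // => /hi_inj <- //.
    by move: t'6; rewrite !inE => /orP[]/eqP->.
  by have /all_nthP/(_ 6) := at12; rewrite stt; apply.
have : t \in [:: iota 0 12; [seq act 3 i | i <- iota 0 12]].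
  have /allP/(_ t tL)/implyP/(_ t6) // :
    all (fun t => (nth 0 t 6 \in [:: 6; 11]) ==> (t \in [:: iota 0 12;
      [seq act 3 i | i <- iota 0 12]])) L.
  by vm_compute.
rewrite !inE => /orP[]/eqP et.
  rewrite (_ : g = 1) ?group1 //; apply/permP; elim/vertexP=> [x ltx|j ltj].
    by rewrite perm1 (fix_lo _ ltx g2).
  by rewrite gt // et nth_iota // perm1.
rewrite (_ : g = rho 3) ?mem_interval //; apply/permP;
  elim/vertexP=> [x ltx|j ltj].
  by rewrite (fix_lo _ ltx g2) ?rho_lo.
by rewrite gt // et (nth_map 0) ?size_iota // nth_iota // rho_hi.
Qed.

(* The generators of labels 2, 3 and 4 generate PSL(2, 11) in its action on the
   11 points of the Paley biplane, whose blocks are listed here. *)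
Definition biplane : seq (seq nat) :=
  [:: [:: 1; 2; 5; 9; 11]; [:: 1; 2; 6; 8; 10]; [:: 1; 3; 4; 10; 11];
      [:: 1; 3; 6; 7; 9]; [:: 1; 4; 5; 7; 8]; [:: 2; 3; 4; 5; 6];
      [:: 2; 3; 7; 8; 11]; [:: 2; 4; 7; 9; 10]; [:: 3; 5; 8; 9; 10];
      [:: 4; 6; 8; 9; 11]; [:: 5; 6; 7; 10; 11]]%N.

Lemma biplane_rho : all (fun k => all (fun b => sort leq [seq act k i | i <- b]
  \in biplane) biplane) [:: 2; 3; 4].
Proof. by vm_compute. Qed.

Lemma gen_sub_biplane g : g \in H (I 2 5) ->
  exists t, [/\ forall b, b \in biplane -> sort leq [seq nth 0 t i | i <- b]
    \in biplane,
    size t = 12%N, all (gtn 12) t & forall j, j < 12 -> g (hi j) = hi (nth 0 t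
      j)].
Proof.
apply: gen_sub_tuple => [[k ltk]||[k ltk] t]; rewrite ?inE /=; first by lia.
  by apply/allP; vm_compute.
move=> pk st _ tB b bB.
(* Blocks are kept as sorted lists; sorting before [act k] is applied does not affect the sorted
   result. *)
have -> : sort leq [seq nth 0 [seq act k i | i <- t] i | i <- b] =
          sort leq [seq act k i | i <- sort leq [seq nth 0 t i | i <- b]].
  apply/perm_sortP; [exact: leq_total | exact: leq_trans | exact: anti_leq |].
  rewrite perm_sym; apply: (perm_trans (perm_map _ (permEl (perm_sort _ _)))).
  rewrite -map_comp.
  suff /eq_in_map -> : {in b, act k \o nth 0 t =1 nth 0 [seq act k i | i <- t]}.
    exact: perm_refl.
  move=> i ib /=.
  rewrite (nth_map 0) // st; move: (i) ib; apply/allP.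
  by move: (b) bB; apply/allP; vm_compute.
have kL : k \in [:: 2; 3; 4] by rewrite !inE; lia.
exact: (allP (allP biplane_rho k kL) _ (tB b bB)).
Qed.

Lemma inter_123_234 : H (I 1 4) :&: H (I 2 5) \subset H (I 2 4).
Proof.
apply/subsetP=> g; rewrite inE => /andP[g1 g2].
have [d dH gd] : exists2 d, d \in H (I 2 4) & forall j, 4 <= j < 12 -> g (hi j)
  = d (hi j).
  exact: (gen_sub_tail (p := 1)).
suff : g * d^-1 \in H (I 2 4) by rewrite groupMr // groupV.
have h2 : g * d^-1 \in H (I 2 5).
  by rewrite groupM ?groupV //; apply: gen_sub_intervalS dH.
have htail j : 4 <= j < 12 -> (g * d^-1) (hi j) = hi j.
  by move=> ltj; rewrite permM gd // permK.
rewrite [g * _](_ : _ = 1) ?group1 //; apply/permP=> x; rewrite perm1.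
move: x; elim/vertexP=> [x ltx|j ltj]; first by rewrite (fix_lo _ ltx h2).
have [t [tB st at12 gt]] := gen_sub_biplane h2.
have t12 i : i < 12 -> nth 0 t i < 12.
  by move=> lti; have /all_nthP/(_ i) := at12; rewrite st; apply.
have tE i : 4 <= i < 12 -> nth 0 t i = i.
  move=> lti; apply: hi_inj; first by apply: t12; lia.
    by lia.
  by rewrite -gt ?htail //; lia.
(* If four points of a block are fixed, the image block contains them; they determine the block, so
   its fifth point is fixed too. *)
have block b i : i < 12 -> (i :: b)%SEQ \in biplane -> all (fun j => 4 <= j <
  12) b ->
    all (fun v => (sort leq (v :: b) \in biplane) ==> (v == i)) (iota 0 12) ->
  nth 0 t i = i.
  move=> lti ibB /allP b4 /allP/(_ (nth 0 t i));
    rewrite mem_iota t12 // => /(_ isT)/implyP bi.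
  apply/eqP/bi; have := tB _ ibB;
    rewrite map_cons (_ : [seq nth 0 t j | j <- b] = b) //.
  by rewrite -[RHS]map_id; apply/eq_in_map=> u ub; apply: tE; apply: b4.
have [le4|lt4] := leqP 4 j; first by rewrite htail ?le4.
case: (posnP j) => [->|j0];
  first by rewrite (fix_interval _ _ _ h2) // => -[|[|[|[|[|]]]]].
rewrite gt //; congr hi; case: j ltj lt4 j0 => [|[|[|[|]]]] // _ _ _.
- by apply: (block [:: 4; 5; 7; 8]); vm_compute.
- by apply: (block [:: 4; 7; 9; 10]); vm_compute.
by apply: (block [:: 5; 8; 9; 10]); vm_compute.
Qed.
(** * Conclusion *)

Lemma string_C_rho : string_C_group 5 rho.
Proof.
have invol i : i < 5 -> involution (rho i).
  move=> lti; split; first by rewrite expgS expg1 -{1}(rhoV lti) mulVg.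
  (* [rho i] moves [hi i.-1], also for [i = 0], where this is [hi 0]. *)
  apply/eqP=> /permP/(_ (hi i.-1)); rewrite perm1.
  case: i lti => [|i] lti /=.
    have /= e := val_hi (isT : 0 < 12).
    by move=> /(congr1 val); rewrite rho0E /= e; repeat case: ifP; lia.
  rewrite rho_hi; try lia.
  by case: i lti => [|[|[|[|]]]] //= _ /hi_inj; move/(_ isT isT).
split; first split=> // i j lti ltj ltij.
  have [i2 _] := invol i lti; have [j2 _] := invol j ltj.
  by rewrite expgMn ?i2 ?j2 ?mulg1 //; apply: rho_commute.
apply: intersection_property_intervals; first exact: rho_commute.
move=> p l; rewrite !addnS.
case: l => [|[|[|[|l]]]] ltpl; rewrite ?addn0; try lia.
- by rewrite inter_consecutive ?sub1G //; lia.
- case: p ltpl => [|[|[|p]]] ltp; try lia.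
  + exact: (inter_prefix (t := 2)).
  + exact: inter_12_23.
  + exact: inter_23_34.
- case: p ltpl => [|[|p]] ltp; try lia.
  + exact: (inter_prefix (t := 3)).
  + exact: inter_123_234.
case: p ltpl => [|p] ltp; try lia.
exact: (inter_prefix (t := 4)).
Qed.

(** * Generation of the alternating group *)

Lemma tperm_hi_tau j : 0 < j < 12 -> tperm (hi 0) (hi j) * tau \in H (I 0 5).
Proof.
move=> ltj.
have step k i : 1 < k < 5 -> i < 12 -> tperm (hi 0) (hi i) * tau \in H (I 0 5)
  ->
    tperm (hi 0) (hi (act k i)) * tau \in H (I 0 5).
  move=> ltk lti sk; rewrite -rho_hi //; last by lia.
  by apply: star_step => //; apply: mem_interval; lia.
have s1 : tperm (hi 0) (hi 1) * tau \in H (I 0 5) by apply: star1.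
(* These steps follow a spanning tree, rooted at [hi 1], of the edges with labels 2, 3 and 4. *)
have s2 := step 2 1%N isT isT s1; have s3 := step 3 2 isT isT s2.
have s4 := step 4 3 isT isT s3; have s5 := step 3 4 isT isT s4.
have s6 := step 4 5 isT isT s5; have s10 := step 2 5 isT isT s5.
have s11 := step 2 6 isT isT s6; have s9 := step 3 10 isT isT s10.
have s8 := step 2 9 isT isT s9; have s7 := step 3 8 isT isT s8.
by do 12!(case: j ltj => [|j] ltj //).
Qed.

(** Each [tperm (hi 2) v * c] is a 3-cycle or trivial, and [star_sift] over all vertices turns these
    elements into all even permutations. *)
Lemma even_mem g : odd_perm g = false -> g \in H (I 0 5).
Proof.
move=> evg; pose c := tperm (hi 2) (hi 3).
suff star v : v != hi 2 -> tperm (hi 2) v * c \in H (I 0 5).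
  have -> : g = g * c ^+ odd_perm g by rewrite evg mulg1.
  apply: (star_sift (e := hi 2) (S := setT)); first exact: tperm2.
    by move=> v _; apply: star.
  by apply/subsetP=> x; rewrite inE.
have hi_star j : j < 12 -> j != 2 -> tperm (hi 2) (hi j) * c \in H (I 0 5).
  move=> ltj j2; set s := _ * c.
  have -> : s = s * tau ^+ odd_perm s.
    by rewrite odd_permM !odd_tperm !hi_neq ?mulg1 // eq_sym.
  apply: (star_sift (e := hi 0) (S := [set x in [seq hi j | j <- iota 0 12]]));
    first exact: tau2.
    move=> u; rewrite inE => /mapP[i]; rewrite mem_iota => lti -> i0.
    by apply: tperm_hi_tau; case: i lti i0 => //; rewrite eqxx.
  have hiS i : i < 12 -> hi i \in [set x in [seq hi j | j <- iota 0 12]].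
    by move=> lti; rewrite inE map_f // mem_iota.
  by apply: perm_onM; apply: subset_trans (tperm_on _ _) _;
    rewrite subUset !sub1set !hiS.
(* [rho 0] and [rho 1] fix [hi 2] and [hi 3], so conjugation by them only moves [x]. *)
have conj k x : k < 2 -> tperm (hi 2) x * c \in H (I 0 5) ->
    tperm (hi 2) (rho k x) * c \in H (I 0 5).
  move=> ltk xH; have kH : rho k \in H (I 0 5) by apply: mem_interval; lia.
  have fixk i : 1 < i < 12 -> rho k (hi i) = hi i.
    case: k ltk {kH} => [|[|]] // _ lti; first by rewrite rho0_hi //; lia.
    by rewrite rho_hi; [congr hi; do 12!(case: i lti => [|i] lti //) | |]; lia.
  by rewrite -(groupJr _ kH) conjMg !tpermJ !fixk in xH.
have lo_star l (x : 'I_n) : x < m -> x + l = m -> tperm (hi 2) x * c \in H (I 0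
  5).
  elim: l x => [|l IHl] x ltx; first by lia.
  move=> xl; have ltx1 : x.+1 < n by lia.
  pose y := Ordinal ltx1.
  have yH : tperm (hi 2) y * c \in H (I 0 5).
    have [lty|ley] := ltnP y m; first by apply: IHl => //=; lia.
    have -> : y = hi 0 by apply: val_inj; rewrite val_hi //= ;
      move: ley => /=; lia.
    exact: hi_star.
  (* The edge between [x] and [x + 1] has label 1 for odd [x] and label 0 for even [x]. *)
  have -> : x = rho (odd x) y; last by apply: conj => //; case: odd.
  apply: val_inj; case: (boolP (odd x)) => ox;
    [rewrite rho1E | rewrite rho0E]; rewrite /= ox /=;
    by repeat case: ifP; lia.
elim/vertexP: v => [x ltx _|j ltj j2]; first by apply: (lo_star (m - x)); lia.
by apply: hi_star => //; apply: contraNneq j2 => ->.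
Qed.

Lemma gen_grp_Alt : gen_grp 5 rho = 'Alt_('I_n) :> {set _}.
Proof.
have -> : gen_grp 5 rho = H (I 0 5) :> {set _}.
  congr <<_>>; apply/setP=> g; apply/imsetP/imsetP=> -[k _ ->]; exists k => //.
  by rewrite inE ltn_ord.
apply/setP=> g; rewrite Alt_even; case: (boolP (odd_perm g)) => /= og.
  by apply: contraTF og => /gen_sub_even->.
by apply: even_mem; apply: negPf.
Qed.

(** * Orders of the products of consecutive generators *)

Definition act2 (k i : nat) : nat := act k.+1 (act k i).

Lemma iter_act2_lt k d j : k < 4 -> j < 12 -> iter d (act2 k) j < 12.
Proof.
by move=> ltk ltj; elim: d => //= d IHd; rewrite !act_lt //; lia.
Qed.

Lemma expg_rho_hi k d j : 0 < k < 4 -> j < 12 ->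
  ((rho k * rho k.+1) ^+ d) (hi j) = hi (iter d (act2 k) j).
Proof.
move=> /andP[k0 ltk] ltj; rewrite permX; elim: d => // d IHd.
have lti := iter_act2_lt d ltk ltj.
by rewrite !iterS IHd permM !rho_hi ?act_lt ?k0 //; lia.
Qed.

(** On the first [m] vertices the product acts as [rho 1] if [k = 1], which needs an even exponent,
    and trivially if [k > 1]. *)
Lemma expg_rho_lo k d (x : 'I_n) : 0 < k < 4 -> (1 < k) || ~~ odd d -> x < m ->
  ((rho k * rho k.+1) ^+ d) x = x.
Proof.
move=> ltk kd ltx; rewrite permX.
suff -> : iter d (rho k * rho k.+1) x = if odd d then rho k x else x.
  by case: ifP kd => // _ /orP[lt1k|//]; apply: rho_lo.
elim: d {kd} => [|d IHd] //; rewrite iterS IHd permM /=.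
have [lek1|lt1k] := leqP k 1; last by rewrite fun_if !rho_lo ?if_same //; lia.
have -> : k = 1%N by lia.
by case: odd; rewrite /= ?rhoK // rho_lo // rho1_lo.
Qed.

(** The order divides [d], and every proper divisor of [d] is excluded by a vertex that the
    corresponding power moves. *)
Lemma order_rho k d : 0 < k < 4 -> 0 < d -> (1 < k) || ~~ odd d ->
    all (fun j => iter d (act2 k) j == j) (iota 0 12) ->
    all (fun e => has (fun j => iter e (act2 k) j != j) (iota 0 12))
      [seq e <- divisors d | e != d] ->
  #[rho k * rho k.+1] = d.
Proof.
move=> ltk d0 kd /allP fd /allP nfd; set g := rho k * rho k.+1.
have gd : #[g] %| d.
  rewrite order_dvdn; apply/eqP/permP=> x; rewrite perm1; move: x.
  elim/vertexP=> [x ltx|j ltj]; first exact: expg_rho_lo.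
  by rewrite expg_rho_hi //; congr hi; apply/eqP/fd; rewrite mem_iota.
apply/eqP/negP=> /negP gnd.
have /nfd/hasP[j] : #[g] \in [seq e <- divisors d | e != d].
  by rewrite mem_filter gnd -dvdn_divisors.
rewrite mem_iota => ltj /eqP; apply; apply: hi_inj => //.
  by apply: iter_act2_lt => //; case/andP: ltk.
by rewrite -expg_rho_hi // expg_order perm1.
Qed.

(** Position of vertex [i] on the cycle [0, 2, ..., m + 1, m, m - 2, ..., 1] of [rho 0 * rho 1];
    recall that [m] is odd. *)
Definition cycle_pos (i : nat) : nat :=
  if odd i then m.+2 - uphalf i else half i.

Lemma cycle_pos_step (x : 'I_n) : x <= m.+1 ->
  (rho 0 * rho 1)%g x <= m.+1 /\
  cycle_pos ((rho 0 * rho 1)%g x) = (cycle_pos x).+1 %[mod m.+2].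
Proof.
move=> lex; set y := _ x; have /= e0 := rho0E x.
have /= : val y = _ := etrans (congr1 val (permM _ _ _)) (rho1E _).
rewrite e0; move: (nat_of_ord y) => v ey.
suff [lev [->|[-> ->]]] : v <= m.+1 /\
   (cycle_pos v = (cycle_pos x).+1 \/ (cycle_pos x).+1 = m.+2 /\ cycle_pos v =
     0%N).
- by [].
- by rewrite modnn mod0n.
by move: ey; rewrite /cycle_pos; repeat case: ifP; lia.
Qed.

Lemma cycle_pos_expg d (x : 'I_n) : x <= m.+1 ->
  ((rho 0 * rho 1) ^+ d)%g x <= m.+1 /\
  cycle_pos (((rho 0 * rho 1) ^+ d)%g x) = cycle_pos x + d %[mod m.+2].
Proof.
move=> lex; rewrite permX; elim: d => [|d [led IHd]]; first by rewrite addn0.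
have [leS eS] := cycle_pos_step led; rewrite iterS; split=> //.
by rewrite eS -addn1 -modnDml IHd modnDml -addnA addn1.
Qed.

Lemma order_rho01 : #[rho 0 * rho 1] = m.+2.
Proof.
have pos_lt i : i <= m.+1 -> cycle_pos i < m.+2 by rewrite /cycle_pos;
  case: ifP; lia.
set g := rho 0 * rho 1.
apply/eqP; rewrite eqn_dvd; apply/andP; split.
  rewrite order_dvdn; apply/eqP/permP=> x; rewrite perm1.
  case: (leqP x m.+1) => [lex|ltx].
    have [leg] := cycle_pos_expg m.+2 lex;
      rewrite modnDr !modn_small ?pos_lt //.
    (* [cycle_pos] is injective on the path. *)
    move=> epos; apply: val_inj; move: epos leg lex; rewrite /cycle_pos /=.
    by move: (nat_of_ord _) => y; repeat case: ifP; lia.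
  have gx : g x = x.
    rewrite permM rho0_gt; last lia.
    by apply: val_inj; rewrite rho1E /=; repeat case: ifP; lia.
  by rewrite permX iter_fix.
(* Vertex 0 has position 0 and returns to it after [#[g]] steps, so [m.+2] divides [#[g]]. *)
have [_] := cycle_pos_expg #[g] (leq0n _ : (ord0 : 'I_n) <= m.+1).
by rewrite expg_order perm1 add0n /= mod0n => /esym/eqP.
Qed.
End Model.

Theorem theorem4p12 (n : nat) :
  15 <= n -> n %% 4 = 3 ->
  (gen_grp 5 (rho n) \isog 'Alt_('I_n))%g /\
  string_C_group 5 (rho n) /\
  schlafli_type 5 (rho n) [:: n - 10; 6; 6; 5].
Proof.
move=> le15n n_mod4; pose m := n - 12.
have m_mod4 : m %% 4 = 3 by lia.
have -> : n = m.+4.+4.+4 by lia.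
split; first by rewrite (gen_grp_Alt m_mod4) isog_refl.
split; first exact: string_C_rho.
split=> // i lti; case: i lti => [|[|[|[|]]]] //= _.
- by rewrite order_rho01 //; lia.
- by apply: order_rho; vm_compute.
- by apply: order_rho; vm_compute.
- by apply: order_rho; vm_compute.
Qed.
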